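(* Let $p\geq 3$ be a fixed prime, $\ell\geq 1$ an integer, and $P\in\mathbb{F}_p[t]$ a fixed irreducible monic polynomial. Let $c\in\mathbb{F}_p[t]$ with $c\notin(P)$, let $f_{c(t)}(x)=x^{p^\ell}-x+c\in\mathbb{F}_p(t)[x]$ be irreducible, and let $H_{f_{c(t)}}=\mathbb{F}_p(t)[x]/(f_{c(t)}(x))$, of degree $d:=[H_{f_{c(t)}}:\mathbb{F}_p(t)]=p^\ell$. Let $N(d)$ be the number of intermediate fields $L$ with $\mathbb{F}_p(t)\subset L\subset H_{f_{c(t)}}$. Then $N(d)\leq d\,2^{d!}$, where $d!\sim \frac{d^d}{e^d}\sqrt{2\pi d}$ as $d\to\infty$.
   Context: $\mathbb{F}_p(t)$ is the rational function field over the finite field $\mathbb{F}_p$. In the asymptotic formula $\pi$ is the usual real constant. *)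

(* Defs.v *)
From HB Require Import structures.
From mathcomp Require Import all_boot all_order all_algebra all_field.
From mathcomp Require Import all_classical all_reals all_analysis.

Set Implicit Arguments.
Unset Strict Implicit.
Unset Printing Implicit Defensive.

Import Order.TTheory GRing.Theory Num.Theory.
Import numFieldNormedType.Exports.

Local Open Scope ring_scope.

(* As 'F_p is only the field with p elements when p is prime, everything below
   is meant to be used with p prime. *)
Definition ratfun (p : nat) : fieldType := {fraction {poly 'F_p}}.

Definition as_poly (p l : nat) (c : {poly 'F_p}) : {poly ratfun p} :=
  'X^(p ^ l) - 'X + (tofrac c)%:P.

Lemma as_poly_monic (p l : nat) (c : {poly 'F_p}) :
  (1 < p)%N -> (0 < l)%N -> as_poly l c \is monic.
Proof.
move=> p_gt1 l_gt0; have q_gt1 : (1 < p ^ l)%N by rewrite -(exp1n l) ltn_exp2r.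
rewrite monicE /as_poly -addrA lead_coefDl ?lead_coefXn // size_polyXn.
rewrite (leq_ltn_trans (size_polyD _ _)) // gtn_max size_polyN size_polyX.
by rewrite ltnS q_gt1 (leq_ltn_trans (size_polyC_leq1 _)) // ltnS ltnW.
Qed.

Lemma as_poly_mi (p l : nat) (c : {poly 'F_p}) :
  (1 < p)%N -> (0 < l)%N -> irreducible_poly (as_poly l c) ->
  monic_irreducible_poly (as_poly l c).
Proof. by move=> p_gt1 l_gt0 f_irr; split=> //; apply: as_poly_monic. Qed.

(* {poly %/ f} is the quotient by f only when f is monic and not constant (the
   library replaces any other f by 'X), hence the first two proof arguments. *)
Definition as_ext (p l : nat) (c : {poly 'F_p})
    (p_gt1 : (1 < p)%N) (l_gt0 : (0 < l)%N)
    (f_irr : irreducible_poly (as_poly l c)) : fieldExtType (ratfun p) :=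
  {poly %/ as_poly l c with as_poly_mi p_gt1 l_gt0 f_irr}.

(* {subfield H} for H : fieldExtType F consists of the subspaces of H over F
   that are closed under product and contain 1; they contain F, and are fields
   since H is finite-dimensional over F. *)
Definition nb_intermediate_fields (F : fieldType) (H : fieldExtType F)
    (N : nat) : Prop :=
  ([set: {subfield H}] #= `I_N)%classic%card.

(* Main.v *)
Require Import Defs.
From mathcomp Require Import all_boot all_order all_algebra all_field.
From mathcomp Require Import all_classical all_reals all_analysis.
From mathcomp Require Import ring lra.

Import Order.TTheory GRing.Theory Num.Theory.
Import numFieldNormedType.Exports.

Local Open Scope ring_scope.
Local Open Scope classical_set_scope.

(** The extension [H] is generated by the class ['qX] of the variable
    ([adjoin_qX]), and its degree is that of the polynomial ([dim_qfpoly]).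

    Intermediate fields of any simple extension of degree [d] are counted by
    Steinitz's argument.  Such a field [L] is determined by the minimal
    polynomial of the generator over [L] ([minPoly_generator_inj]), because the
    coefficients of this polynomial already generate [L].  It is a monic
    divisor, with coefficients in [H], of the minimal polynomial over the base
    field, and a polynomial of degree [d] has at most [2 ^ d] monic divisors
    ([monic_divisors_enum]).  Hence there are at most [2 ^ d] intermediate
    fields, which is far below [d * 2 ^ d`!].

    Stirling's formula says that
    a(n) = n! e^n / (n^n sqrt n) tends to sqrt (2 pi).  The logarithm of a(n) is
    decreasing and its steps are bounded by those of 1/n
    ([ln_stirling_ratioS]), so a(n) has a positive limit C.  The Wallis
    integrals, i.e. the integrals of sin^n from 0 to pi/2, give
    a(n)^4 / a(2n)^2 -> 2 pi ([wallis_stirling_ratio]), whence C^4 = 2 pi C^2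
    and C = sqrt (2 pi). *)

(** * Intermediate fields of a simple extension *)

(** A divisor of degree at least 1 of smallest possible degree is
    irreducible. *)
Lemma monic_irreducible_factor (K : fieldType) (f : {poly K}) :
  (1 < size f)%N ->
  exists q : {poly K}, [/\ q \is monic, irreducible_poly q & q %| f].
Proof.
move=> f_gt1; pose P m := `[< exists q : {poly K},
  [/\ q \is monic, (1 < size q)%N, q %| f & size q = m] >].
have norm (r : {poly K}) : (1 < size r)%N -> r %| f -> P (size r).
  move=> r_gt1 r_dvd; apply/asboolP; exists ((lead_coef r)^-1 *: r).
  have lr : lead_coef r != 0 by rewrite lead_coef_eq0 -size_poly_gt0 ltnW.
  by rewrite monicE lead_coefZ mulVf // size_scale ?dvdpZl ?invr_eq0.
have exP : exists m, P m by exists (size f); apply: norm.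
have [m /asboolP[q [q_monic q_gt1 q_dvd sz_q]] m_min] := ex_minnP exP.
exists q; split=> //; split=> // r r_neq1 r_dvd.
rewrite -dvdp_size_eqp // eqn_leq dvdp_leq ?monic_neq0 //= sz_q.
apply/m_min/norm; last exact: dvdp_trans q_dvd.
rewrite ltn_neqAle eq_sym r_neq1 size_poly_gt0.
exact: dvdpN0 r_dvd (monic_neq0 q_monic).
Qed.

(** Induction on the degree: if [q] is an irreducible factor of [f], a monic
    divisor of [f] is either [q] times a divisor of [f / q], or prime to [q] and
    then itself a divisor of [f / q].  So the number of divisors at most doubles
    while the degree drops by at least 1. *)
Lemma monic_divisors_enum (K : fieldType) (f : {poly K}) : f != 0 ->
  exists2 s : seq {poly K}, (size s <= 2 ^ (size f).-1)%N &
    forall g, g \is monic -> g %| f -> g \in s.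
Proof.
have [n] := ubnP (size f); elim: n => // n IHn in f * => le_n f_neq0.
have [le1|gt1] := leqP (size f) 1.
  exists [:: 1] => [|g g_monic /(dvdp_leq f_neq0) le_g].
    by rewrite expn_gt0.
  have /size1_polyC gE := leq_trans le_g le1.
  by move: g_monic; rewrite gE monicE lead_coefC => /eqP ->; rewrite mem_head.
have [q [q_monic q_irr q_dvd]] := monic_irreducible_factor K f gt1.
have q_gt1 : (1 < size q)%N by case: q_irr.
have fE := divpK q_dvd.
have f'_neq0 : f %/ q != 0.
  by apply: contra_neq f_neq0 => e; rewrite -fE e mul0r.
have szf : size f = (size (f %/ q)%R + (size q).-1)%N.
  by rewrite -{1}fE size_Mmonic // -!subn1 addnBA // ltnW.
have f'_lt : (size (f %/ q)%R < size f)%N.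
  by rewrite szf -[X in (X < _)%N]addn0 ltn_add2l -ltnS prednK // ltnW.
have [|s sz_s sP] := IHn (f %/ q) _ f'_neq0; first exact: leq_trans f'_lt le_n.
exists (s ++ [seq g * q | g <- s]).
  rewrite size_cat size_map addnn -muln2.
  rewrite (leq_trans (leq_mul sz_s (leqnn 2))) //.
  rewrite -expnSr leq_exp2l // prednK ?size_poly_gt0 //.
  by rewrite -ltnS prednK // size_poly_gt0.
move=> g g_monic g_dvd; rewrite mem_cat; have [q_g|q_ng] := boolP (q %| g).
  apply/orP; right; apply/mapP; exists (g %/ q); last by rewrite divpK.
  apply: sP; first by rewrite -(monicMr _ q_monic) divpK.
  by rewrite -(@dvdp_mul2r _ q) ?monic_neq0 // fE divpK.
apply/orP; left; apply: sP => //.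
by rewrite -(@Gauss_dvdpl _ _ q) ?fE // coprimep_sym irreducible_poly_coprime.
Qed.

Lemma dim_qfpoly (F : fieldType) (f : {poly F})
    (mi : monic_irreducible_poly f) :
  \dim {: {poly %/ f with mi}} = (size f).-1.
Proof. by rewrite dimvf /dim /= (mk_monicE mi). Qed.

Lemma adjoin_qX (F : fieldType) (f : {poly F}) (mi : monic_irreducible_poly f) :
  <<1; 'qX : {poly %/ f with mi}>>%VS = fullv.
Proof.
apply/eqP; rewrite eqEsubv subvf; apply/subvP => v _.
apply/Fadjoin1_polyP; exists (v : {poly F}).
have vE : v = in_qpoly f (v : {poly F}).
  by apply/val_inj/esym/in_qpoly_small/size_mk_monic.
rewrite horner_coef size_map_poly {1}vE -{1}[polyn v]coefK poly_def.
rewrite raddf_sum; apply: eq_bigr => i _.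
by rewrite coef_map /= mulr_algl -rmorphXn linearZ.
Qed.

(** If [L] and [M] give the same polynomial [g], then [g] has coefficients in
    [K = L :&: M], so the degree of [H] over [K] is at most its degree over [L]
    and the tower [K <= L <= H] collapses to [K = L]. *)
Lemma minPoly_generator_inj (F : fieldType) (H : fieldExtType F) (x : H) :
  <<1; x>>%VS = {:H}%VS -> injective (fun L : {subfield H} => minPoly L x).
Proof.
move=> gen; have full (L : {subfield H}) : <<L; x>>%VS = {:H}%VS.
  by apply/eqP; rewrite eqEsubv subvf -gen adjoinSl ?sub1v.
have sub (L M : {subfield H}) : minPoly L x = minPoly M x -> (L <= M)%VS.
  move=> eqLM; pose K := (L :&: M)%AS.
  have overK : minPoly L x \is a polyOver K.
    apply/polyOverP => i; rewrite memv_cap (polyOverP (minPolyOver L x)).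
    by rewrite eqLM (polyOverP (minPolyOver M x)).
  have degK : (adjoin_degree K x <= adjoin_degree L x)%N.
    rewrite -ltnS -!size_minPoly dvdp_leq ?monic_neq0 ?monic_minPoly //.
    by rewrite minPoly_dvdp ?root_minPoly.
  have leLK : (\dim L <= \dim K)%N.
    have dgt0 : (0 < adjoin_degree L x)%N by [].
    rewrite -(leq_pmul2l dgt0) -dim_Fadjoin full -(full K) dim_Fadjoin.
    by rewrite leq_mul2r degK orbT.
  have /eqP <- : K == L :> {vspace H} by rewrite eqEdim capvSl.
  exact: capvSr.
by move=> L M /= e; apply/val_inj/eqP; rewrite eqEsubv !sub.
Qed.

Lemma nb_intermediate_fields_simple (F : fieldType) (H : fieldExtType F)
    (x : H) :
  <<1; x>>%VS = {:H}%VS ->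
  exists2 N, nb_intermediate_fields H N & (N <= 2 ^ \dim {: H})%N.
Proof.
move=> gen; have f_monic := monic_minPoly 1 x.
have [s sz_s sP] :=
  monic_divisors_enum _ (minPoly 1 x) (monic_neq0 f_monic).
have degE : \dim {:H} = adjoin_degree 1 x.
  by rewrite -gen dim_Fadjoin dimv1 muln1.
have card_le : ([set: {subfield H}] #<= `I_(2 ^ \dim {:H}))%card.
  have inS (L : {subfield H}) : minPoly L x \in s.
    by rewrite sP ?monic_minPoly // minPolyS // sub1v.
  have inj : {in [set: {subfield H}] &,
      injective (fun L : {subfield H} => index (minPoly L x) s)}.
    move=> L M _ _ /= e; have := @minPoly_generator_inj _ _ _ gen L M; apply.
    by rewrite -(nth_index 0 (inS L)) e nth_index.
  rewrite -(card_le_eql (inj_card_eq inj)); apply: subset_card_le.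
  move=> _ [L _ <-] /=; rewrite (leq_trans _ (leq_trans sz_s _)) ?index_mem //.
  by rewrite size_minPoly degE.
have /finite_setP[N NP] : finite_set [set: {subfield H}].
  by apply/finite_set_leP; exists (2 ^ \dim {:H})%N.
by exists N => //; rewrite -card_le_II -(card_le_eql NP).
Qed.

Lemma size_as_poly (p l : nat) (c : {poly 'F_p}) :
  (1 < p)%N -> (0 < l)%N -> size (as_poly l c) = (p ^ l).+1.
Proof.
move=> p_gt1 l_gt0; have q_gt1 : (1 < p ^ l)%N by rewrite -(exp1n l) ltn_exp2r.
rewrite /as_poly -addrA size_polyDl size_polyXn //.
rewrite (leq_ltn_trans (size_polyD _ _)) // gtn_max size_polyN size_polyX ltnS.
by rewrite q_gt1 (leq_ltn_trans (size_polyC_leq1 _)) // ltnS ltnW.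
Qed.

(** * Wallis integrals *)

Lemma ger0_is_derive_le (R : realType) (f df : R -> R) (a b : R) : a <= b ->
  (forall x, a <= x <= b -> is_derive x 1 f (df x)) ->
  (forall x, a <= x <= b -> 0 <= df x) -> f a <= f b.
Proof.
move=> ab fP df_ge0.
have itv x : x \in `]a, b[%R -> a <= x <= b.
  by rewrite in_itv /= => /andP[/ltW -> /ltW ->].
apply: (@ger0_derive1_ndecr _ f a b) => //.
- by move=> x /itv/fP[].
- by move=> x /itv xab; have [_ dfx] := fP _ xab; rewrite derive1E dfx df_ge0.
apply: derivable_within_continuous => x; rewrite in_itv /= => xab.
by have [] := fP x xab.
Qed.

(** The integral of [sin ^+ n] from [0] to [pi / 2], given by its recurrence so
    that all its algebraic properties follow by induction. *)
Fixpoint wallis (R : realType) (n : nat) : R :=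
  match n with
  | 0 => pi / 2
  | 1 => 1
  | m.+2 => m.+1%:R / m.+2%:R * wallis R m
  end.

(** This identifies [wallis R n] as the integral of [sin ^+ n].  The step comes
    from
    (sin^(n+1) cos)' = (n+1) sin^n - (n+2) sin^(n+2),
    where sin^(n+1) cos vanishes at both 0 and pi/2; as it goes from [n] to
    [n.+2], the induction carries two consecutive ranks. *)
Lemma wallis_primitive (R : realType) (n : nat) : exists F : R -> R,
  (forall x : R, is_derive x 1 F (sin x ^+ n)) /\ F (pi / 2) - F 0 = wallis R n.
Proof.
suff [] : (exists F : R -> R, (forall x : R, is_derive x 1 F (sin x ^+ n)) /\
      F (pi / 2) - F 0 = wallis R n) /\
    (exists F : R -> R, (forall x : R, is_derive x 1 F (sin x ^+ n.+1)) /\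
      F (pi / 2) - F 0 = wallis R n.+1) by [].
elim: n => [|n [[F [dF FE]] IH]]; split=> //.
- exists id; split=> [x|]; last by rewrite subr0.
  by rewrite expr0; exact: is_derive_id.
- exists (- cos); split=> [x|].
    by rewrite expr1; apply: is_derive_eq; rewrite opprK.
  by rewrite !fctE cos_pihalf cos0 /=; lra.
exists (n.+2%:R^-1 *: (n.+1%:R *: F - sin ^+ n.+1 * cos)).
have n2_neq0 : n.+2%:R != 0 :> R by [].
split=> [x|].
  have dFx := dF x; apply: is_derive_eq.
  rewrite /GRing.scale /= fctE -/(sin x).
  have cc : cos x * cos x = 1 - sin x * sin x by rewrite -!expr2 cos2sin2.
  rewrite mulrC [cos x * _]mulrC -[_ * cos x * cos x]mulrA cc !exprS.
  move: n2_neq0; rewrite -[n.+2%:R]natr1; move: (n.+1%:R : R) => k k_neq0.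
  by field.
rewrite !fctE /= -FE sin0 cos_pihalf expr0n /GRing.scale /=.
by move: n2_neq0; move: (n.+2%:R : R) => k k_neq0; field.
Qed.

Lemma wallis_gt0 (R : realType) n : 0 < wallis R n.
Proof.
have [m] := ubnP n; elim: m => // m IHm in n *; case: n => [|[|n]] //= lt_nm.
  by rewrite divr_gt0 ?pi_gt0.
by rewrite mulr_gt0 ?divr_gt0 ?IHm // ltnW.
Qed.

(** The powers of the sine decrease on [0, pi/2], and so do their integrals. *)
Lemma wallis_nincr (R : realType) n : wallis R n.+1 <= wallis R n.
Proof.
have [F [dF <-]] := wallis_primitive R n.
have [G [dG <-]] := wallis_primitive R n.+1.
have pi2_ge0 : 0 <= pi / 2 :> R by rewrite divr_ge0 ?pi_ge0.
have : F 0 - G 0 <= F (pi / 2) - G (pi / 2).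
  apply: (@ger0_is_derive_le _ (F - G)
    (fun x => sin x ^+ n - sin x ^+ n.+1)) => // x.
  move=> /andP[x_ge0 x_le]; rewrite exprS -{1}[sin x ^+ n]mul1r -mulrBl.
  rewrite mulr_ge0 ?subr_ge0 ?sin_le1 // exprn_ge0 // sin_ge0_pi //.
  by rewrite x_ge0 (le_trans x_le) // ler_pdivrMr // ler_peMr ?pi_ge0 // ler1n.
lra.
Qed.

Lemma wallis_mul (R : realType) n :
  n.+1%:R * (wallis R n * wallis R n.+1) = pi / 2.
Proof.
elim: n => [|n IHn]; first by rewrite /=; ring.
rewrite -IHn /=; have : n.+2%:R != 0 :> R by [].
by move: (n.+2%:R : R) => k k_neq0; field.
Qed.

Lemma wallis_even (R : realType) n :
  wallis R n.*2 = pi / 2 * ((n.*2)`!%:R / (4 ^+ n * n`!%:R ^+ 2)).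
Proof.
elim: n => [|n IHn]; first by rewrite /= expr0 fact0; field.
rewrite doubleS /= IHn !factS !natrM [4 ^+ n.+1]exprS.
have : n`!%:R != 0 :> R by rewrite pnatr_eq0 -lt0n fact_gt0.
have : 4 ^+ n != 0 :> R by rewrite expf_neq0.
have : n.+1%:R != 0 :> R by [].
have -> : (n.*2).+2%:R = 2 * n.+1%:R :> R.
  by rewrite -doubleS -muln2 natrM mulrC.
move: (n.+1%:R : R) (4 ^+ n : R) (n`!%:R : R) ((n.*2).+1%:R : R) => k u v w.
by move=> k_neq0 u_neq0 v_neq0; field; rewrite k_neq0 u_neq0 v_neq0.
Qed.

(** * Stirling's formula *)

(** The power series is 2 t + 2 t^3 / 3 + ...; both bounds follow by comparing
    derivatives.  Any upper bound 2 t + O(t^3) would give summable steps in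
    [ln_stirling_ratioS]. *)
Lemma ln_ratio_bounds (R : realType) (t : R) : 0 <= t <= 1 / 3 ->
  2 * t <= ln (1 + t) - ln (1 - t) <= 2 * t + t ^+ 3.
Proof.
move=> /andP[t_ge0 t_le].
pose L : R -> R := (@ln R \o (cst 1 + id)) - (@ln R \o (cst 1 - id)).
have dL (x : R) : 0 <= x <= t -> is_derive x 1 L ((1 + x)^-1 + (1 - x)^-1).
  move=> /andP[x_ge0 x_le].
  have dp : is_derive ((cst 1 + id) x) 1 (@ln R) (1 + x)^-1.
    by apply: is_derive1_ln; change (0 < 1 + x); lra.
  have dm : is_derive ((cst 1 - id) x) 1 (@ln R) (1 - x)^-1.
    by apply: is_derive1_ln; change (0 < 1 - x); lra.
  have dpL := is_derive1_comp dp; have dmL := is_derive1_comp dm.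
  by apply: is_derive_eq; ring.
have LE x : L x = ln (1 + x) - ln (1 - x) by [].
have L0 : L 0 = 0 by rewrite LE addr0 subr0 subrr.
rewrite -LE; apply/andP; split.
  have : (L - 2 *: id) 0 <= (L - 2 *: id) t.
    apply: (@ger0_is_derive_le _ (L - 2 *: id)
      (fun x => (1 + x)^-1 + (1 - x)^-1 - 2)) => // x x_itv.
      have dx := dL x x_itv; apply: is_derive_eq.
      by rewrite /GRing.scale /= mulr1.
    have [x_ge0 x_le] := andP x_itv.
    have -> : (1 + x)^-1 + (1 - x)^-1 - 2 = 2 * x ^+ 2 / ((1 + x) * (1 - x)).
      by field; apply/andP; split; lra.
    by rewrite divr_ge0 ?mulr_ge0 ?exprn_ge0 //; lra.
  by rewrite !fctE L0 /GRing.scale /= mulr0 subr0 subr_ge0.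
pose U : R -> R := 2 *: id + id ^+ 3 - L.
have dU (x : R) : 0 <= x <= t ->
    is_derive x 1 U (2 + 3 * x ^+ 2 - ((1 + x)^-1 + (1 - x)^-1)).
  move=> /dL dx; apply: is_derive_eq.
  by rewrite /GRing.scale /= !mulr1.
have UE x : U x = 2 * x + x ^+ 3 - L x by [].
rewrite -subr_ge0 -UE -[leLHS](_ : U 0 = 0); last first.
  by rewrite UE L0 mulr0 expr0n /= addr0 subr0.
move: U dU {UE} => U dU; apply: (ger0_is_derive_le _ _ _ _ _ t_ge0 dU) => x.
move=> /andP[x_ge0 x_le].
have -> : 2 + 3 * x ^+ 2 - ((1 + x)^-1 + (1 - x)^-1) =
   x ^+ 2 * (1 - 3 * x ^+ 2) / ((1 + x) * (1 - x)).
  by field; apply/andP; split; lra.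
have x2_le : x ^+ 2 <= 1 / 9 by rewrite expr2; nra.
by rewrite divr_ge0 ?mulr_ge0 ?exprn_ge0 //; lra.
Qed.

(** The logarithm of n! e^n / (n^n sqrt n). *)
Definition ln_stirling_ratio (R : realType) (n : nat) : R :=
  ln n`!%:R + n%:R - (n%:R + 1 / 2) * ln n%:R.

(** With k = n + 1, the difference is (k + 1/2) ln (1 + 1/k) - 1.  For
    t = 1 / (2 k + 1), one has 1 + 1/k = (1 + t) / (1 - t) and
    k + 1/2 = 1 / (2 t), so the difference lies between 0 and
    t^2 / 2 <= 1 / (k (k + 1)). *)
Lemma ln_stirling_ratioS (R : realType) n :
  0 <= ln_stirling_ratio R n.+1 - ln_stirling_ratio R n.+2
    <= n.+1%:R^-1 - n.+2%:R^-1.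
Proof.
rewrite /ln_stirling_ratio [n.+2`!]factS natrM lnM ?posrE ?ltr0n ?fact_gt0 //.
set k : R := n.+1%:R; have kE : n.+2%:R = k + 1 by rewrite -natr1.
have k_ge1 : 1 <= k by rewrite ler1n.
rewrite kE; set t := (2 * k + 1)^-1.
have t_itv : 0 <= t <= 1 / 3.
  rewrite invr_ge0; apply/andP; split; first lra.
  by rewrite div1r lef_pV2 ?posrE; lra.
have := ln_ratio_bounds R t t_itv.
have -> : ln (1 + t) - ln (1 - t) = ln (k + 1) - ln k.
  rewrite -!ln_div ?posrE; try lra.
  by congr ln; rewrite /t; field; apply/and3P; split; lra.
set d := ln (k + 1) - ln k => /andP[d_ge d_le].
have -> : ln n.+1`!%:R + k - (k + 1 / 2) * ln k -
   (ln (k + 1) + ln n.+1`!%:R + (k + 1) - (k + 1 + 1 / 2) * ln (k + 1)) =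
   (k + 1 / 2) * d - 1.
  by rewrite /d; field.
have k2 : (k + 1 / 2) * (2 * t) = 1 by rewrite /t; field; lra.
have k3 : (k + 1 / 2) * t ^+ 3 <= k^-1 - (k + 1)^-1.
  have -> : (k + 1 / 2) * t ^+ 3 = (2 * (2 * k + 1) ^+ 2)^-1.
    by rewrite /t; field; lra.
  have -> : k^-1 - (k + 1)^-1 = (k * (k + 1))^-1.
    by field; apply/andP; split; lra.
  by rewrite lef_pV2 ?posrE; nra.
have k12 : 0 <= k + 1 / 2 by lra.
have := ler_wpM2l k12 d_ge; have := ler_wpM2l k12 d_le.
rewrite [_ * (_ + t ^+ 3)]mulrDr k2 => h1 h2; rewrite subr_ge0 h2 /=.
by rewrite lerBlDl (le_trans h1) // lerD2l.
Qed.

(** The sequence is nonincreasing from rank 1 on, while its difference with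
    1/n is nondecreasing and starts at 0.  So it is bounded below, by 1/n. *)
Lemma ln_stirling_ratio_cvg (R : realType) : cvgn (ln_stirling_ratio R).
Proof.
have ge_inv n : n.+1%:R^-1 <= ln_stirling_ratio R n.+1.
  elim: n => [|n IHn].
    by rewrite /ln_stirling_ratio factS fact0 muln1 ln1 invr1; lra.
  have /andP[_] := ln_stirling_ratioS R n; move: IHn.
  by move: (n.+1%:R^-1 : R) (n.+2%:R^-1 : R) => u v; lra.
suff cvgS : cvgn [sequence ln_stirling_ratio R n.+1]_n.
  apply: (cvgP (limn [sequence ln_stirling_ratio R n.+1]_n)).
  by rewrite -cvg_shiftS.
apply: nonincreasing_is_cvgn.
  apply/nonincreasing_seqP => n; have /andP[] := ln_stirling_ratioS R n.
  by rewrite subr_ge0.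
by exists 0 => _ [n _ <-]; rewrite /mkset (le_trans _ (ge_inv n)) ?invr_ge0.
Qed.

Lemma fact_stirling_ratio (R : realType) n : (0 < n)%N ->
  n`!%:R =
    expR (ln_stirling_ratio R n) * (n%:R ^+ n / expR 1 ^+ n * Num.sqrt n%:R).
Proof.
move=> n_gt0; rewrite /ln_stirling_ratio.
have n0 : 0 < n%:R :> R by rewrite ltr0n.
have -> : Num.sqrt n%:R = expR (1 / 2 * ln n%:R) :> R.
  by rewrite -powR12_sqrt ?ltW // /powR gt_eqF // div1r.
have -> : n%:R ^+ n = expR (n%:R * ln n%:R) :> R.
  by rewrite mulrC expRM_natr lnK.
rewrite -expRM_natl -expRN -!expRD mulr1.
by rewrite -[LHS]lnK ?posrE ?ltr0n ?fact_gt0 //; congr expR; ring.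
Qed.

(** Let W be the integral of sin^(2n).  Writing the factorials of [wallis_even]
    in terms of A = a(n) and B = a(2n), the powers n^n and e^n cancel
    and W^2 = pi^2 B^2 / (2 n A^4).  On the other hand
    pi / (4 n + 2) <= W^2 <= pi / (4 n), as W lies between its two neighbours,
    whose products with W are known from [wallis_mul]. *)
Lemma wallis_stirling_ratio (R : realType) n : (0 < n)%N ->
  2 * pi * expR (ln_stirling_ratio R n.*2) ^+ 2
    <= expR (ln_stirling_ratio R n) ^+ 4
    <= 2 * pi * expR (ln_stirling_ratio R n.*2) ^+ 2 * (1 + n%:R^-1).
Proof.
move=> n_gt0; set A := expR (_ _ n); set B := expR (_ _ n.*2).
set w := wallis R n.*2.
have w_gt0 : 0 < w by exact: wallis_gt0.
have n0 : 0 < n%:R :> R by rewrite ltr0n.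
have A_gt0 : 0 < A by exact: expR_gt0.
have B_gt0 : 0 < B by exact: expR_gt0.
have n2E : (n.*2)%:R = 2 * n%:R :> R by rewrite -muln2 natrM mulrC.
have w2E : w ^+ 2 * (2 * A ^+ 4 * n%:R) = pi ^+ 2 * B ^+ 2.
  rewrite /w wallis_even !fact_stirling_ratio ?double_gt0 // -/A -/B.
  set s := Num.sqrt n%:R; have sE : n%:R = s ^+ 2 by rewrite sqr_sqrtr ?ltW.
  set s' := Num.sqrt (n.*2)%:R.
  have s'E : s' ^+ 2 = 2 * n%:R by rewrite sqr_sqrtr ?n2E.
  have -> : (n.*2)%:R ^+ n.*2 = 4 ^+ n * (n%:R ^+ n) ^+ 2 :> R.
    have -> : 4 = 2 ^+ 2 :> R by rewrite -natrX.
    by rewrite n2E -!exprM mul2n muln2 exprMn.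
  have -> : expR 1 ^+ n.*2 = (expR 1 ^+ n) ^+ 2 :> R by rewrite -exprM muln2.
  have u_gt0 : 0 < expR 1 ^+ n :> R by rewrite exprn_gt0 ?expR_gt0.
  have v_gt0 : 0 < 4 ^+ n :> R by rewrite exprn_gt0.
  have k_gt0 : 0 < n%:R ^+ n :> R by rewrite exprn_gt0.
  have s_gt0 : 0 < s by rewrite sqrtr_gt0.
  move: u_gt0 v_gt0 k_gt0 s'E.
  move: (expR 1 ^+ n) (4 ^+ n : R) (n%:R ^+ n : R).
  move=> u v k u_gt0 v_gt0 k_gt0 s'E.
  have -> : pi / 2 *
      (B * (v * k ^+ 2 / u ^+ 2 * s') / (v * (A * (k / u * s)) ^+ 2)) =
      pi * B * s' / (2 * A ^+ 2 * n%:R).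
    by rewrite sE; field; rewrite !gt_eqF.
  by rewrite expr_div_n !exprMn s'E; field; rewrite !gt_eqF.
have w_le : 4 * n%:R * w ^+ 2 <= pi.
  have := wallis_mul R n.*2.-1; have := wallis_nincr R n.*2.-1.
  rewrite prednK ?double_gt0 // n2E -/w.
  move: (wallis R n.*2.-1) => w' w'_ge /(congr1 ( *%R 2)).
  rewrite [2 * (pi / 2)]mulrC mulfVK // => <-.
  have : 4 * n%:R * w * w <= 4 * n%:R * w * w'.
    by rewrite ler_wpM2l // !mulr_ge0 // ltW.
  lra.
have w_ge : pi <= (4 * n%:R + 2) * w ^+ 2.
  have := wallis_mul R n.*2; have := wallis_nincr R n.*2.
  rewrite -natr1 n2E -/w.
  move: (wallis R n.*2.+1) => w' w'_le /(congr1 ( *%R 2)).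
  rewrite [2 * (pi / 2)]mulrC mulfVK // => <-.
  have : (4 * n%:R + 2) * w * w' <= (4 * n%:R + 2) * w * w.
    by rewrite ler_wpM2l // mulr_ge0 ?addr_ge0 ?mulr_ge0 // ltW.
  lra.
have pi0 := pi_gt0 R.
have A4 : 0 < A ^+ 4 by rewrite exprn_gt0.
have B2 : 0 < B ^+ 2 by rewrite exprn_gt0.
have w2 : 0 < w ^+ 2 by rewrite exprn_gt0.
apply/andP; split.
  rewrite -(ler_pM2l pi0).
  have -> : pi * (2 * pi * B ^+ 2) = 4 * n%:R * w ^+ 2 * A ^+ 4 by lra.
  by rewrite ler_wpM2r // ltW.
have -> : 1 + n%:R^-1 = (n%:R + 1) / n%:R :> R by field; rewrite gt_eqF.
rewrite mulrA ler_pdivlMr // -(ler_pM2l pi0).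
have pi_le : pi <= (4 * n%:R + 4) * w ^+ 2 by lra.
have An : 0 <= A ^+ 4 * n%:R by rewrite mulr_ge0 // ltW.
have w2E' : 2 * (n%:R + 1) * (w ^+ 2 * (2 * A ^+ 4 * n%:R)) =
    2 * (n%:R + 1) * (pi ^+ 2 * B ^+ 2) by rewrite w2E.
have := ler_wpM2r An pi_le; lra.
Qed.

(** If C is the limit of a(n), then a(2n) also tends to C, and the squeeze of
    [wallis_stirling_ratio] becomes C^4 = 2 pi C^2.  Dividing by C^2 is possible
    because C is the exponential of a limit. *)
Lemma stirling_ratio_cvg (R : realType) :
  expR (ln_stirling_ratio R n) @[n --> \oo] --> (Num.sqrt (2 * pi) : R).
Proof.
set c := limn (ln_stirling_ratio R).
have cvgA : expR (ln_stirling_ratio R n) @[n --> \oo] --> expR c.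
  apply: continuous_cvg; [exact: continuous_expR|].
  exact: ln_stirling_ratio_cvg.
have cvgB : expR (ln_stirling_ratio R n.*2) @[n --> \oo] --> expR c.
  apply: (@cvg_comp _ _ _ double (fun n => expR (ln_stirling_ratio R n))
    _ _ _ _ cvgA).
  apply/cvgnyPge => N; exists N => // n /= le_Nn.
  by rewrite (leq_trans le_Nn) // -addnn leq_addr.
suff -> : Num.sqrt (2 * pi) = expR c by [].
have pi2 : 0 <= 2 * pi :> R by rewrite mulr_ge0 ?pi_ge0.
have cvgX k (u : nat -> R) (a : R) :
    u n @[n --> \oo] --> a -> u n ^+ k @[n --> \oo] --> a ^+ k.
  by move=> ua; have := continuous_cvg _ (@exprn_continuous R k a) ua; apply.
have cvgA4 := cvgX 4 _ _ cvgA.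
have lo : 2 * pi * expR (ln_stirling_ratio R n.*2) ^+ 2 @[n --> \oo] -->
    2 * pi * expR c ^+ 2.
  by apply: cvgMl_tmp; exact: cvgX cvgB.
have inv0 : n%:R^-1 @[n --> \oo] --> (0 : R).
  by rewrite -cvg_shiftS; exact: cvg_harmonic.
have hi : 2 * pi * expR (ln_stirling_ratio R n.*2) ^+ 2 * (1 + n%:R^-1)
    @[n --> \oo] --> 2 * pi * expR c ^+ 2.
  have one : 1 + n%:R^-1 @[n --> \oo] --> (1 + 0 : R).
    exact: (cvgD (@cvg_cst R^o 1 nat \oo _) inv0).
  by have := cvgM lo one; rewrite addr0 mulr1; apply.
have c4 : expR c ^+ 4 = 2 * pi * expR c ^+ 2.
  apply: cvg_unique cvgA4 _ => //.
  apply: squeeze_cvgr lo hi; exists 1%N => // n /= n_gt0.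
  exact: wallis_stirling_ratio.
have c2 : expR c ^+ 2 != 0 by rewrite expf_neq0 ?gt_eqF ?expR_gt0.
have : expR c ^+ 2 = 2 * pi.
  by apply: (mulIf c2); rewrite -c4 -exprD.
by move=> <-; rewrite sqrtr_sqr ger0_norm ?expR_ge0.
Qed.

Theorem stirling (R : realType) :
  (fun n : nat => n`!%:R : R) ~_\oo
      (fun n : nat => n%:R ^+ n / expR 1 ^+ n * Num.sqrt (2 * pi * n%:R)).
Proof.
apply/eqaddoP => e /= e_gt0.
have /cvgrPdist_le/(_ (e * Num.sqrt (2 * pi))) := @stirling_ratio_cvg R.
have s_gt0 : 0 < Num.sqrt (2 * pi) :> R by rewrite sqrtr_gt0 mulr_gt0 ?pi_gt0.
move=> /(_ (mulr_gt0 e_gt0 s_gt0)).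
apply: filterS2 (nbhs_infty_gt 0) => n n_gt0 /= dist_le.
have pi2 : 0 <= 2 * pi :> R by rewrite mulr_ge0 ?pi_ge0.
rewrite !fctE fact_stirling_ratio // sqrtrM //.
rewrite [_ * (Num.sqrt (2 * pi) * _)]mulrCA; move: (_ / _ * Num.sqrt n%:R) => m.
rewrite -mulrBl !normrM distrC mulrA.
by rewrite ler_wpM2r // (ger0_norm (ltW s_gt0)).
Qed.

(** * The theorem *)

Theorem corollary13p1 (R : realType) (p l : nat) (P c : {poly 'F_p})
    (p_prime : prime p) (p_ge3 : (3 <= p)%N) (l_ge1 : (1 <= l)%N)
    (P_monic : P \is monic) (P_irr : irreducible_poly P)
    (c_notin_P : ~~ (P %| c))
    (f_irr : irreducible_poly (as_poly l c)) :
  let H := as_ext (prime_gt1 p_prime) l_ge1 f_irr in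
  let d := \dim {: H} in
  [/\ d = (p ^ l)%N,
      exists2 N : nat, nb_intermediate_fields H N & (N <= d * 2 ^ d`!)%N
    & (fun n : nat => n`!%:R : R) ~_\oo
      (fun n : nat => n%:R ^+ n / expR 1 ^+ n * Num.sqrt (2 * pi * n%:R))].
Proof.
move=> H d; have f_mi := as_poly_mi (prime_gt1 p_prime) l_ge1 f_irr.
have dE : d = (p ^ l)%N.
  by rewrite [d](dim_qfpoly _ _ f_mi) size_as_poly // prime_gt1.
have d_gt0 : (0 < d)%N by rewrite dE expn_gt0 prime_gt0.
split=> //; last exact: stirling.
have [N NP N_le] := nb_intermediate_fields_simple _ H _ (adjoin_qX _ _ f_mi).
exists N => //; apply: leq_trans N_le _.
rewrite -[X in (X <= _)%N]mul1n leq_mul // leq_exp2l //.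
exact: fact_geq.
Qed.
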